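(* Let $(V_1,\|\cdot\|_1)$ and $(V_2,\|\cdot\|_2)$ be real normed spaces, let $G\in\Delta^+$ with $G\neq\epsilon_0$ and $G\ne\epsilon_{+\infty}$, and let $(V_1,\|\cdot\|_1,G,\tau_M,\mathbf M)$ and $(V_2,\|\cdot\|_2,G,\tau_M,\mathbf M)$ be the corresponding simple PN spaces under $\tau_M$ and $\mathbf M$. Let $\|\cdot\|_3$ be the norm on $V_1\times V_2$ defined by $\|\bar p\|_3:=\max\{\|p_1\|_1,\|p_2\|_2\}$ for $\bar p=(p_1,p_2)\in V_1\times V_2$. Then $(V_1\times V_2,\|\cdot\|_3,G,\tau_M,\mathbf M)$ is a simple PN space that coincides with the $\mathbf M$-product of the two given simple spaces. Furthermore it is a Šerstnev space.
   Context: $\Delta^+$ is the set of distance distribution functions: nondecreasing $F:[0,+\infty]\to[0,1]$ with $F(0)=0$, $F(+\infty)=1$, left-continuous on $(0,+\infty)$; it is ordered pointwise and endowed with the topology of weak convergence. $\epsilon_0(x)=0$ for $x\le0$ and $1$ for $x>0$; $\epsilon_{+\infty}(x)=0$ for $x<+\infty$ and $\epsilon_{+\infty}(+\infty)=1$. A triangle function is a binary operation on $\Delta^+$ that is commutative, associative, nondecreasing in each argument and has $\epsilon_0$ as identity. The triangle functions $\tau_M$ and $\mathbf M$ are $\tau_M(F,H)(x)=\sup_{s+t=x}\min\{F(s),H(t)\}$ and $\mathbf M(F,H)(x)=\min\{F(x),H(x)\}$. A PN space is a quadruple $(V,\nu,\tau,\tau^* )$ where $V$ is a real linear space with null vector $\theta$,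 $\tau,\tau^*$ are continuous (for weak convergence) triangle functions with $\tau\le\tau^*$, and $\nu:V\to\Delta^+$, $p\mapsto\nu_p$, satisfies: (N1) $\nu_p=\epsilon_0$ iff $p=\theta$; (N2) $\nu_{-p}=\nu_p$; (N3) $\nu_{p+q}\ge\tau(\nu_p,\nu_q)$; (N4) $\nu_p\le\tau^*(\nu_{\alpha p},\nu_{(1-\alpha)p})$ for all $\alpha\in[0,1]$; for all $p,q\in V$. It is a Šerstnev space if moreover $\nu_p=\tau_M(\nu_{\alpha p},\nu_{(1-\alpha)p})$ for all $\alpha\in[0,1]$, $p\in V$. The simple PN space $(V,\|\cdot\|,G,\tau_M,\mathbf M)$ is the PN space $(V,\nu,\tau_M,\mathbf M)$ with $\nu_\theta=\epsilon_0$ and $\nu_p(t)=G(t/\|p\|)$ for $p\ne\theta$. The $\mathbf M$-product of $(V_1,\nu_1,\tau_M,\mathbf M)$ and $(V_2,\nu_2,\tau_M,\mathbf M)$ is $V_1\times V_2$ with $\nu^{\mathbf M}(p_1,p_2):=\mathbf M(\nu_1(p_1),\nu_2(p_2))$ and the triangle functions $\tau_M,\mathbf M$. *)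

(* Defs.v *)
From HB Require Import structures.
From mathcomp Require Import all_boot all_order all_algebra.
From mathcomp Require Import all_classical all_reals all_analysis.

Set Implicit Arguments.
Unset Strict Implicit.
Unset Printing Implicit Defensive.

From mathcomp Require Import lra.
Import Order.TTheory GRing.Theory Num.Theory.
Import numFieldNormedType.Exports.

Local Open Scope classical_set_scope.
Local Open Scope ring_scope.

(* The set Delta^+. A function on [0, +oo] is represented by its extension by
   0 to the whole extended real line; is_ddf_le0 contains F(0) = 0. *)
Record is_ddf (R : realType) (F : \bar R -> R) : Prop := IsDdf {
  is_ddf_nd : forall x y, (x <= y)%E -> F x <= F y ;
  is_ddf_ge0 : forall x, 0 <= F x ;
  is_ddf_le1 : forall x, F x <= 1 ;
  is_ddf_le0 : forall x, (x <= 0)%E -> F x = 0 ;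
  is_ddf_pinfty : F +oo%E = 1 ;
  is_ddf_left : forall x : R, 0 < x -> F y%:E @[y --> x^'-] --> F x%:E
}.

Record ddf (R : realType) := Ddf {
  ddf_fun :> \bar R -> R ;
  ddf_axiom : is_ddf ddf_fun
}.

Section ddf_theory.
Context {R : realType} (F : ddf R).

Lemma ddf_nd x y : (x <= y)%E -> F x <= F y.
Proof. exact: is_ddf_nd (ddf_axiom F) _ _. Qed.

Lemma ddf_ge0 x : 0 <= F x.
Proof. exact: is_ddf_ge0 (ddf_axiom F) _. Qed.

Lemma ddf_le1 x : F x <= 1.
Proof. exact: is_ddf_le1 (ddf_axiom F) _. Qed.

Lemma ddf_le0 x : (x <= 0)%E -> F x = 0.
Proof. exact: is_ddf_le0 (ddf_axiom F) _. Qed.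

Lemma ddf_pinfty : F +oo%E = 1.
Proof. exact: is_ddf_pinfty (ddf_axiom F). Qed.

Lemma ddf_left (x : R) : 0 < x -> F y%:E @[y --> x^'-] --> F x%:E.
Proof. exact: is_ddf_left (ddf_axiom F) _. Qed.

End ddf_theory.

Arguments ddf_left {R} F [x] _.

Lemma ddfP (R : realType) (F H : ddf R) : (forall x, F x = H x) -> F = H.
Proof.
case: F H => [F FP] [H HP] /= /funext FH.
by subst H; congr Ddf; exact: Prop_irrelevance.
Qed.

Definition ddf_leq (R : realType) (F H : ddf R) : Prop :=
  forall x, F x <= H x.

HB.instance Definition _ (R : realType) := gen_eqMixin (ddf R).
HB.instance Definition _ (R : realType) := gen_choiceMixin (ddf R).

Lemma nd_left_cvg (R : realType) (f : \bar R -> R) (x : R) :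
  (forall y z, (y <= z)%E -> f y <= f z) ->
  (forall e, 0 < e -> exists2 y, y < x & f x%:E - e < f y%:E) ->
  f y%:E @[y --> x^'-] --> f x%:E.
Proof.
move=> nd fx; apply/cvgrPdist_lt => e /fx[y yx fy].
near=> z.
have zx : f z%:E <= f x%:E.
  by apply: nd; rewrite lee_fin; near: z; exact: nbhs_left_le.
rewrite ger0_norm ?subr_ge0// ltrBlDl -ltrBlDr.
apply: (lt_le_trans fy); apply: nd; rewrite lee_fin.
by near: z; exact: nbhs_left_ge.
Unshelve. all: by end_near. Qed.

Lemma ddf_left_lt (R : realType) (F : ddf R) (x a : R) : 0 < x ->
  a < F x%:E -> exists2 y, y < x & a < F y%:E.
Proof.
move=> x0 aF; have /cvgr_gt/(_ _ aF) h := ddf_left F x0.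
near x^'- => y; exists y; last by near: y.
by near: y; exact: nbhs_left_lt.
Unshelve. all: by end_near. Qed.

Section Topology.
Variable R : realType.
Implicit Types (F H K : ddf R) (x y : R).

Definition continuity_point F x := {for x, continuous (fun y => F y%:E)}.

(* Basic neighbourhoods of F are {H | |H x - F x| < e for all x in s}, with s a
   finite list of continuity points of F; see weak_cvgP. *)
Definition weak_nbhs F : set_system (ddf R) :=
  [set U | exists (s : seq R) (e : R), [/\ 0 < e,
     forall x, x \in s -> continuity_point F x &
     forall H, (forall x, x \in s -> `|H x%:E - F x%:E| < e) -> U H]].

HB.instance Definition _ := hasNbhs.Build (ddf R) weak_nbhs.

Lemma continuity_point_dense F (a b : R) : a < b ->
  exists2 x, a < x < b & continuity_point F x.
Proof.
move=> ab; apply: contrapT => h.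
have nd : nondecreasing (fun y : R => F y%:E).
  by move=> y z yz; exact: ddf_nd.
have := @discontinuity_countable R a b (fun y => F y%:E) (in2W nd).
move/countable_lebesgue_measure0.
set D := [set x | _]; have -> : D = `]a, b[%classic.
  apply/seteqP; split => [x []//|x /= xab]; split => //.
  have cl : cvg (F y%:E @[y --> x^'-]).
    apply: nondecreasing_at_left_is_cvgr; near=> z; first exact: in2W.
    by exists 1 => _ [y _ <-]; exact: ddf_le1.
  have cr : cvg (F y%:E @[y --> x^'+]).
    apply: nondecreasing_at_right_is_cvgr; near=> z; first exact: in2W.
    by exists 0 => _ [y _ <-]; exact: ddf_ge0.
  split => //; apply/eqP => lr; apply: h; exists x => //.
  have lF : lim (F y%:E @[y --> x^'-]) <= F x%:E.
    apply: limr_le => //; near=> z; apply: nd.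
    by near: z; exact: nbhs_left_le.
  have rF : F x%:E <= lim (F y%:E @[y --> x^'+]).
    apply: limr_ge => //; near=> z; apply: nd.
    by near: z; exact: nbhs_right_ge.
  have El : lim (F y%:E @[y --> x^'-]) = F x%:E.
    by apply/eqP; rewrite eq_le lF lr rF.
  apply/left_right_continuousP; split; first by rewrite -El.
  by rewrite -El lr.
rewrite lebesgue_measure_itv/= lte_fin ab -EFinB => -[] /eqP.
by rewrite subr_eq0 gt_eqF.
Unshelve. all: by end_near. Qed.

Lemma weak_nbhs_filter F : ProperFilter (weak_nbhs F).
Proof.
split.
- by move=> [s [e [e0 _ /(_ F)]]]; apply => x _; rewrite subrr normr0.
- split.
  + by exists [::], 1; split.
  + move=> U V [s [e [e0 sF sU]]] [t [d [d0 tF tV]]].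
    exists (s ++ t), (Num.min e d); split.
    * by rewrite lt_min e0.
    * by move=> x; rewrite mem_cat => /orP[/sF|/tF].
    * move=> H sH; split; [apply: sU|apply: tV] => x xs.
        have /sH : x \in s ++ t by rewrite mem_cat xs.
        by rewrite lt_min => /andP[].
      have /sH : x \in s ++ t by rewrite mem_cat xs orbT.
      by rewrite lt_min => /andP[].
  + move=> U V UV [s [e [e0 sF sU]]]; exists s, e; split => // H /sU.
    exact: UV.
Qed.

Lemma weak_nbhs_singleton F (U : set (ddf R)) : weak_nbhs F U -> U F.
Proof.
by move=> [s [e [e0 _ /(_ F)]]]; apply => x _; rewrite subrr normr0.
Qed.

Lemma weak_nbhs_point F x e : continuity_point F x -> 0 < e ->
  weak_nbhs F [set H | `|H x%:E - F x%:E| < e].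
Proof.
move=> Fx e0; exists [:: x], e; split => //.
  by move=> y; rewrite inE => /eqP ->.
by move=> H; apply; rewrite inE.
Qed.

Lemma weak_nbhs_nbhs_point F x e : continuity_point F x -> 0 < e ->
  weak_nbhs F
    [set K | weak_nbhs K [set H | `|H x%:E - F x%:E| < e]].
Proof.
move=> Fx e0.
have e20 : 0 < e / 2 by rewrite divr_gt0.
have /cvgrPdist_lt/(_ _ e20)/nbhs_ballP[d /= d0 dF] := Fx.
have [y /andP[xy yx] Fy] : exists2 y, x - d < y < x & continuity_point F y.
  by apply: continuity_point_dense; rewrite ltrBlDr ltrDl.
have [z /andP[xz zx] Fz] : exists2 z, x < z < x + d & continuity_point F z.
  by apply: continuity_point_dense; rewrite ltrDl.
have {}yF : `|F x%:E - F y%:E| < e / 2.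
  apply: dF; rewrite /ball/= gtr0_norm ?subr_gt0//.
  by rewrite ltrBlDr -ltrBlDl.
have {}zF : `|F x%:E - F z%:E| < e / 2.
  by apply: dF; rewrite /ball/= ltr0_norm ?subr_lt0// opprB ltrBlDl.
have := @filterI _ _ (weak_nbhs_filter F) _ _
  (weak_nbhs_point Fy e20) (weak_nbhs_point Fz e20).
apply: (@filterS _ _ (weak_nbhs_filter F)) => K /= [Ky Kz].
have [u /andP[yu ux] Ku] := continuity_point_dense K yx.
have [v /andP[xv vz] Kv] := continuity_point_dense K xz.
have uK : F x%:E - e < K u%:E.
  have : K y%:E <= K u%:E by apply: ddf_nd; rewrite lee_fin ltW.
  move: Ky yF; rewrite !ltr_norml => /andP[h1 h2] /andP[h3 h4] h5.
  by lra.
have vK : K v%:E < F x%:E + e.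
  have : K v%:E <= K z%:E by apply: ddf_nd; rewrite lee_fin ltW.
  move: Kz zF; rewrite !ltr_norml => /andP[h1 h2] /andP[h3 h4] h5.
  by lra.
pose a := Num.min (K u%:E - (F x%:E - e)) (F x%:E + e - K v%:E).
have a0 : 0 < a by rewrite /a lt_min !subr_gt0 uK vK.
have := @filterI _ _ (weak_nbhs_filter K) _ _
  (weak_nbhs_point Ku a0) (weak_nbhs_point Kv a0).
apply: (@filterS _ _ (weak_nbhs_filter K)) => H /= [].
rewrite /a !lt_min => /andP[h1 _] /andP[_ h2].
have h3 : H u%:E <= H x%:E by apply: ddf_nd; rewrite lee_fin ltW.
have h4 : H x%:E <= H v%:E by apply: ddf_nd; rewrite lee_fin ltW.
move: h1 h2; rewrite !ltr_norml => /andP[h5 h6] /andP[h7 h8].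
by apply/andP; split; lra.
Qed.

Lemma weak_nbhs_nbhs F (U : set (ddf R)) :
  weak_nbhs F U -> weak_nbhs F (weak_nbhs^~ U).
Proof.
move=> [s [e [e0 sF sU]]].
have : weak_nbhs F [set K | weak_nbhs K
    [set H | forall x, x \in s -> `|H x%:E - F x%:E| < e]].
  elim: s sF {sU} => [_|x s ih xsF].
    have FF := weak_nbhs_filter F; apply: filterE => K.
    by have FK := weak_nbhs_filter K; apply: filterE.
  have Fx : continuity_point F x by apply: xsF; rewrite mem_head.
  have sF y : y \in s -> continuity_point F y.
    by move=> ys; apply: xsF; rewrite inE ys orbT.
  have FF := weak_nbhs_filter F.
  apply: filterS2 (weak_nbhs_nbhs_point Fx e0) (ih sF) => K /=.
  have FK := weak_nbhs_filter K.
  apply: filterS2 => H /= Hx Hs y; rewrite inE => /predU1P[->//|].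
  exact: Hs.
have FF := weak_nbhs_filter F; apply: filterS => K /=.
have FK := weak_nbhs_filter K; apply: filterS => H /=.
exact: sU.
Qed.

HB.instance Definition _ := Nbhs_isNbhsTopological.Build (ddf R)
  weak_nbhs_filter weak_nbhs_singleton weak_nbhs_nbhs.

Lemma weak_cvgP (T : Type) (E : set_system T) (f : T -> ddf R) F :
  Filter E ->
  f @ E --> F <->
  forall x, continuity_point F x -> f t x%:E @[t --> E] --> F x%:E.
Proof.
move=> EE; split=> [fF x Fx|fF].
  apply/cvgrPdist_lt => e e0; have /= := fF _ (weak_nbhs_point Fx e0).
  by rewrite nbhs_simpl/=; apply: filterS => t /=; rewrite distrC.
move=> U [s [e [e0 sF sU]]].
suff : \forall t \near E, forall x, x \in s -> `|f t x%:E - F x%:E| < e.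
  by move=> fs; change (E (fun t => U (f t))); apply: filterS fs => t; exact: sU.
elim: s sF {sU} => [_|x s ih xsF]; first exact: filterE.
have Fx : continuity_point F x by apply: xsF; rewrite mem_head.
have sF y : y \in s -> continuity_point F y.
  by move=> ys; apply: xsF; rewrite inE ys orbT.
have /cvgrPdist_lt/(_ _ e0) fx := fF _ Fx.
apply: filterS2 (ih sF) fx => t ts tx y; rewrite inE => /predU1P[->|/ts//].
by rewrite distrC.
Qed.

End Topology.

Section Operations.
Variable R : realType.
Implicit Types F G H : ddf R.

Definition eps0_fun (x : \bar R) : R := if (0 < x)%E then 1 else 0.

Lemma eps0_is_ddf : is_ddf eps0_fun.
Proof.
have nd x y : (x <= y)%E -> eps0_fun x <= eps0_fun y.
  move=> xy; rewrite /eps0_fun; case: ltP => [x0|_].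
    by rewrite (lt_le_trans x0 xy).
  by case: ifP.
split; first exact: nd.
- by move=> x; rewrite /eps0_fun; case: ifP.
- by move=> x; rewrite /eps0_fun; case: ifP.
- by move=> x x0; rewrite /eps0_fun ltNge x0.
- by rewrite /eps0_fun ltry.
- move=> x x0; apply: nd_left_cvg; first exact: nd.
  move=> e e0; exists (x / 2); first by lra.
  by rewrite /eps0_fun !lte_fin x0 divr_gt0// ltrBlDr ltrDl.
Qed.

Definition eps0 : ddf R := Ddf eps0_is_ddf.

Definition epsy_fun (x : \bar R) : R := if x == +oo%E then 1 else 0.

Lemma epsy_is_ddf : is_ddf epsy_fun.
Proof.
have nd x y : (x <= y)%E -> epsy_fun x <= epsy_fun y.
  move=> xy; rewrite /epsy_fun; case: eqP => [xoo|_].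
    by move: xy; rewrite xoo leye_eq => ->.
  by case: ifP.
split; first exact: nd.
- by move=> x; rewrite /epsy_fun; case: ifP.
- by move=> x; rewrite /epsy_fun; case: ifP.
- by move=> x x0; rewrite /epsy_fun; case: eqP x0 => // ->.
- by rewrite /epsy_fun eqxx.
- by move=> x x0; exact: cvg_cst.
Qed.

Definition epsy : ddf R := Ddf epsy_is_ddf.

Definition minM_fun F H (x : \bar R) : R := Num.min (F x) (H x).

Lemma minM_is_ddf F H : is_ddf (minM_fun F H).
Proof.
have nd x y : (x <= y)%E -> minM_fun F H x <= minM_fun F H y.
  by move=> xy; rewrite /minM_fun le_min !ge_min !ddf_nd ?orbT.
split; first exact: nd.
- by move=> x; rewrite /minM_fun le_min !ddf_ge0.
- by move=> x; rewrite /minM_fun ge_min !ddf_le1.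
- by move=> x x0; rewrite /minM_fun !ddf_le0// minxx.
- by rewrite /minM_fun !ddf_pinfty minxx.
- move=> x x0; apply: nd_left_cvg; first exact: nd.
  move=> e e0; have : minM_fun F H x%:E - e < minM_fun F H x%:E.
    by rewrite ltrBlDr ltrDl.
  rewrite {2}/minM_fun lt_min => /andP[].
  move=> /(ddf_left_lt x0)[y yx Fy] /(ddf_left_lt x0)[z zx Hz].
  exists (Num.max y z); first by rewrite gt_max yx.
  rewrite {2}/minM_fun lt_min (lt_le_trans Fy) ?(lt_le_trans Hz)//.
  - by apply: ddf_nd; rewrite lee_fin le_max lexx orbT.
  - by apply: ddf_nd; rewrite lee_fin le_max lexx.
Qed.

Definition minM F H : ddf R := Ddf (minM_is_ddf F H).

Definition tauM_set F H (x : \bar R) : set R :=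
  [set r | exists s t : \bar R,
     [/\ (0 <= s)%E, (0 <= t)%E, (s + t)%E = x & r = Num.min (F s) (H t)]].

(* The supremum is 0 for x < 0, where tauM_set is empty. *)
Definition tauM_fun F H (x : \bar R) : R := sup (tauM_set F H x).

Lemma tauM_set_ub F H x : ubound (tauM_set F H x) 1.
Proof. by move=> _ [s [t [_ _ _ ->]]]; rewrite ge_min ddf_le1. Qed.

Lemma tauM_set_n0 F H x : (0 <= x)%E -> tauM_set F H x !=set0.
Proof.
by move=> x0; exists (Num.min (F x) (H 0%E)), x, 0%E; rewrite adde0.
Qed.

Lemma tauM_set_lt0 F H x : (x < 0)%E -> tauM_set F H x = set0.
Proof.
move=> x0; rewrite -subset0 => r [s [t [s0 t0 stx _]]].
by move: x0; rewrite -stx ltNge adde_ge0.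
Qed.

Lemma tauM_set_sup F H x : (0 <= x)%E -> has_sup (tauM_set F H x).
Proof.
by move=> x0; split; [exact: tauM_set_n0|exists 1; exact: (@tauM_set_ub F H x)].
Qed.

Lemma tauM_fun_ub F H s t : (0 <= s)%E -> (0 <= t)%E ->
  Num.min (F s) (H t) <= tauM_fun F H (s + t).
Proof.
move=> s0 t0; apply: ub_le_sup; first by exists 1; exact: (@tauM_set_ub F H).
by exists s, t.
Qed.

Lemma tauM_fun_ge0 F H x : 0 <= tauM_fun F H x.
Proof.
have [x0|x0] := leP 0%E x; last by rewrite /tauM_fun tauM_set_lt0// sup0.
rewrite -[x]adde0 (le_trans _ (tauM_fun_ub F H x0 (lexx 0%E)))//.
by rewrite le_min !ddf_ge0.
Qed.

Lemma tauM_is_ddf F H : is_ddf (tauM_fun F H).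
Proof.
have nd x y : (x <= y)%E -> tauM_fun F H x <= tauM_fun F H y.
  move=> xy; have [x0|x0] := leP 0%E x; last first.
    by rewrite {1}/tauM_fun tauM_set_lt0// sup0 tauM_fun_ge0.
  apply: ge_sup; first exact: tauM_set_n0.
  move=> _ [s [t [s0 t0 stx ->]]].
  have [ty|ty] := eqVneq t +oo%E.
    have -> : y = (s + t)%E.
      apply/eqP; move: xy; rewrite -stx ty addey; last first.
        by rewrite gt_eqF// (lt_le_trans _ s0).
      by rewrite leye_eq.
    exact: tauM_fun_ub.
  have tfin : t \is a fin_num by rewrite ge0_fin_numE// ltey.
  have sy : (s <= y - t)%E by rewrite leeBrDr// stx.
  rewrite -(subeK y tfin) (le_trans _ (tauM_fun_ub F H (le_trans s0 sy) t0))//.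
  by rewrite le_min !ge_min (ddf_nd F sy) lexx orbT.
split; first exact: nd.
- exact: tauM_fun_ge0.
- move=> x; have [x0|x0] := leP 0%E x; last first.
    by rewrite /tauM_fun tauM_set_lt0// sup0.
  by apply: ge_sup; [exact: tauM_set_n0|exact: tauM_set_ub].
- move=> x; rewrite le_eqVlt => /predU1P[->|x0]; last first.
    by rewrite /tauM_fun tauM_set_lt0// sup0.
  apply/eqP; rewrite eq_le tauM_fun_ge0 andbT.
  apply: ge_sup; first exact: tauM_set_n0.
  move=> _ [s [t [s0 t0 st0 ->]]].
  rewrite ge_min (ddf_le0 F) ?lexx// -st0.
  by rewrite leeDl.
- apply/eqP; rewrite eq_le; apply/andP; split.
    by apply: ge_sup; [exact: tauM_set_n0|exact: tauM_set_ub].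
  have y0 : (0 <= +oo :> \bar R)%E by rewrite leey.
  by have := tauM_fun_ub F H y0 y0; rewrite !ddf_pinfty minxx.
- move=> x x0; apply: nd_left_cvg; first exact: nd.
  move=> e e0; have [lt0|ge0] := ltP (tauM_fun F H x%:E - e) 0.
    exists (x - 1); first by rewrite ltrBlDr ltrDl.
    by rewrite (lt_le_trans lt0)// tauM_fun_ge0.
  have x0' : (0 <= x%:E)%E by rewrite lee_fin ltW.
  have [_ [s [t [s0 t0 stx ->]]]] := sup_adherent e0 (tauM_set_sup F H x0').
  rewrite -/(tauM_fun F H x%:E) lt_min => /andP[Fs Ht].
  have left (K : ddf R) (r : R) : tauM_fun F H x%:E - e < K r%:E ->
      exists r', [/\ 0 <= r', r' < r & tauM_fun F H x%:E - e < K r'%:E].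
    move=> Kr; have pos r' : tauM_fun F H x%:E - e < K r'%:E -> 0 < r'.
      move=> Kr'; rewrite ltNge; apply/negP => r'0.
      by move: Kr'; rewrite ddf_le0// ltNge ge0.
    have [r' r'r Kr'] := ddf_left_lt (pos _ Kr) Kr.
    by exists r'; split => //; rewrite ltW// pos.
  case: s s0 stx Fs => [s| |] s0 //; last first.
    by rewrite addye// gt_eqF// (lt_le_trans _ t0).
  case: t t0 Ht => [t| |] t0 Ht; [|by []|by []].
  move=> [stx] Fs.
  have [s' [s'0 s's Fs']] := left _ _ Fs.
  have [t' [t'0 t't Ht']] := left _ _ Ht.
  exists (s' + t'); first by rewrite -stx ltrD.
  rewrite EFinD (lt_le_trans _ (tauM_fun_ub F H _ _)) ?lee_fin//.
  by rewrite lt_min Fs'.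
Qed.

Definition tauM F H : ddf R := Ddf (tauM_is_ddf F H).

Definition dilate_fun G (c : R) (x : \bar R) : R := G (x * c^-1%:E)%E.

Lemma dilate_is_ddf G (c : R) (c0 : 0 < c) : is_ddf (dilate_fun G c).
Proof.
have nd x y : (x <= y)%E -> dilate_fun G c x <= dilate_fun G c y.
  move=> xy; apply: ddf_nd; rewrite lee_wpmul2r// lee_fin.
  by rewrite invr_ge0 ltW.
split; first exact: nd.
- by move=> *; exact: ddf_ge0.
- by move=> *; exact: ddf_le1.
- by move=> x x0; apply: ddf_le0; rewrite mule_le0_ge0// lee_fin invr_ge0 ltW.
- rewrite /dilate_fun gt0_mulye ?ddf_pinfty//.
  by rewrite lte_fin invr_gt0.
- move=> x x0; apply: nd_left_cvg; first exact: nd.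
  move=> e e0; have xc0 : 0 < x / c by rewrite divr_gt0.
  have : G (x / c)%:E - e < G (x / c)%:E by rewrite ltrBlDr ltrDl.
  move=> /(ddf_left_lt xc0)[y yx Gy]; exists (y * c).
    by rewrite -ltr_pdivlMr.
  by rewrite /dilate_fun -!EFinM mulfK// gt_eqF.
Qed.

Definition dilate G (c : R) (c0 : 0 < c) : ddf R := Ddf (dilate_is_ddf G c0).

End Operations.

Section PN.
Variable R : realType.

Definition triangle_function (tau : ddf R -> ddf R -> ddf R) : Prop :=
  [/\ commutative tau, associative tau,
      forall F F' H H', ddf_leq F F' -> ddf_leq H H' ->
        ddf_leq (tau F H) (tau F' H') &
      left_id (eps0 R) tau /\ right_id (eps0 R) tau].

Definition weakly_continuous (tau : ddf R -> ddf R -> ddf R) : Prop :=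
  continuous (fun FH : ddf R * ddf R => tau FH.1 FH.2).

(* A bare quadruple (V, nu, tau, tau* ); the axioms are in is_PN_space. *)
Record quadruple := Quadruple {
  carrier : lmodType R ;
  nu : carrier -> ddf R ;
  tau : ddf R -> ddf R -> ddf R ;
  taustar : ddf R -> ddf R -> ddf R
}.

Record is_PN_space (S : quadruple) : Prop := {
  PN_tau : triangle_function (tau S) /\ weakly_continuous (tau S) ;
  PN_taustar : triangle_function (taustar S) /\ weakly_continuous (taustar S) ;
  PN_le : forall F H, ddf_leq (tau S F H) (taustar S F H) ;
  PN_N1 : forall p : carrier S, nu p = eps0 R <-> p = 0 ;
  PN_N2 : forall p : carrier S, nu (- p) = nu p ;
  PN_N3 : forall p q : carrier S, ddf_leq (tau S (nu p) (nu q)) (nu (p + q)) ;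
  PN_N4 : forall (a : R) (p : carrier S), 0 <= a <= 1 ->
    ddf_leq (nu p) (taustar S (nu (a *: p)) (nu ((1 - a) *: p)))
}.

Definition is_Serstnev_space (S : quadruple) : Prop :=
  is_PN_space S /\
  forall (a : R) (p : carrier S), 0 <= a <= 1 ->
    nu p = tauM (nu (a *: p)) (nu ((1 - a) *: p)).

Lemma norm_gt0_neq0 (V : normedModType R) (p : V) : p <> 0 -> 0 < `|p|.
Proof. by move=> /eqP; rewrite normr_gt0. Qed.

Definition simple_nu (V : normedModType R) (G : ddf R) (p : V) : ddf R :=
  match pselect (p = 0) with
  | left _ => eps0 R
  | right p0 => dilate G (norm_gt0_neq0 p0)
  end.

Lemma simple_nu0 (V : normedModType R) (G : ddf R) :
  simple_nu G (0 : V) = eps0 R.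
Proof. by rewrite /simple_nu; case: pselect. Qed.

Lemma simple_nuE (V : normedModType R) (G : ddf R) (p : V) (t : \bar R) :
  p <> 0 -> simple_nu G p t = G (t * `|p|^-1%:E)%E.
Proof. by rewrite /simple_nu; case: pselect. Qed.

Definition simple_space (V : normedModType R) (G : ddf R) : quadruple :=
  @Quadruple V (@simple_nu V G) (@tauM R) (@minM R).

Definition M_product (S1 S2 : quadruple) : quadruple :=
  @Quadruple (carrier S1 * carrier S2)%type
    (fun p => minM (nu p.1) (nu p.2)) (@tauM R) (@minM R).

End PN.

(* Main.v *)
Require Import Defs.
From HB Require Import structures.
From mathcomp Require Import all_boot all_order all_algebra.
From mathcomp Require Import all_classical all_reals all_analysis.
From mathcomp Require Import lra.

Set Implicit Arguments.
Unset Strict Implicit.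
Unset Printing Implicit Defensive.

Import Order.TTheory GRing.Theory Num.Theory.
Import numFieldNormedType.Exports.

Local Open Scope classical_set_scope.
Local Open Scope ring_scope.

(* A simple distribution p |-> G(./|p|) depends only on |p| and decreases with
   it, so the distribution of a pair, whose norm is the larger of the two norms,
   is the smaller of the two distributions. The Serstnev identity holds because
   the splitting x = a x + (1 - a) x attains the supremum defining tau_M. Weak
   continuity of a triangle function T at (F, H) reduces to lower semicontinuity
   of (F, H) |-> T(F, H)(x), and to the fact that T(F, H)(y) < b forces
   T(F', H')(x) <= b near (F, H) for x < y; for tau_M the latter is read off
   the single level sup {s | F s < b}. *)

(** * Order on distance distribution functions and the algebraic laws of tau_M and M *)

Section Triangle.
Variable R : realType.
Implicit Types (F G H K : ddf R) (x y s t : R).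

Lemma ddf_leq_pos F H :
  (forall x, 0 < x -> F x%:E <= H x%:E) -> ddf_leq F H.
Proof.
move=> FH [x| |]; last by rewrite !ddf_le0// leNye.
- by have [/FH//|x0] := ltP 0 x; rewrite !ddf_le0.
- by rewrite !ddf_pinfty.
Qed.

Lemma ddf_leq_anti F H : ddf_leq F H -> ddf_leq H F -> F = H.
Proof. by move=> FH HF; apply: ddfP => x; apply/eqP; rewrite eq_le FH HF. Qed.

Lemma ddf_leq_eps0 F : ddf_leq F (eps0 R).
Proof.
by apply: ddf_leq_pos => x x0; rewrite /= /eps0_fun lte_fin x0 ddf_le1.
Qed.

Lemma ddf_gt0 F x a : 0 <= a -> a < F x%:E -> 0 < x.
Proof.
move=> a0 aF; rewrite ltNge; apply/negP => x0.
by move: aF; rewrite ddf_le0// ltNge a0.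
Qed.

(** The supremum in tau_M need not be attained, so it is handled through strict lower bounds, with
    [tauM_ge] as converse. As [a] is nonnegative and F, H vanish at nonpositive arguments, both
    summands are positive; they are finite because x is. *)
Lemma tauM_lt F H x a : 0 <= a -> a < tauM F H x%:E ->
  exists s t, [/\ 0 < s, 0 < t, s + t = x, a < F s%:E & a < H t%:E].
Proof.
move=> a0 aT; have x0 : (0 <= x%:E)%E by rewrite lee_fin ltW// (ddf_gt0 a0 aT).
have [_ [s [t [s0 t0 stx ->]]]] := sup_gt (tauM_set_n0 F H x0) aT.
rewrite lt_min => /andP[Fs Ht].
case: s s0 stx Fs => [s| |] s0 //; last first.
  by rewrite addye// gt_eqF// (lt_le_trans _ t0).
case: t t0 Ht => [t| |] t0 Ht // [stx] Fs.
by exists s, t; split; rewrite // (ddf_gt0 a0 Fs, ddf_gt0 a0 Ht).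
Qed.

Lemma tauM_ge F H s t : 0 <= s -> 0 <= t ->
  Num.min (F s%:E) (H t%:E) <= tauM F H (s + t)%:E.
Proof. by move=> s0 t0; rewrite EFinD; apply: tauM_fun_ub; rewrite lee_fin. Qed.

Lemma tauM_leq F H K :
  (forall s t, 0 < s -> 0 < t ->
    Num.min (F s%:E) (H t%:E) <= K (s + t)%:E) ->
  ddf_leq (tauM F H) K.
Proof.
move=> FHK; apply: ddf_leq_pos => x x0; rewrite leNgt; apply/negP.
move=> /(tauM_lt (ddf_ge0 _ _))[s [t [s0 t0 <- Fs Ht]]].
have := FHK _ _ s0 t0; rewrite leNgt lt_min => /negP; apply.
by rewrite Fs Ht.
Qed.

Lemma tauM_le_minM F H : ddf_leq (tauM F H) (minM F H).
Proof.
apply: tauM_leq => s t s0 t0; rewrite /= /minM_fun le_min !ge_min.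
by rewrite (ddf_nd F) ?(ddf_nd H) ?orbT// lee_fin; lra.
Qed.

Lemma tauMC : commutative (@tauM R).
Proof.
suff h F H : ddf_leq (tauM F H) (tauM H F) by move=> F H; exact: ddf_leq_anti.
by apply: tauM_leq => s t s0 t0; rewrite minC addrC tauM_ge// ltW.
Qed.

Lemma tauM_monotone F F' H H' : ddf_leq F F' -> ddf_leq H H' ->
  ddf_leq (tauM F H) (tauM F' H').
Proof.
move=> FF HH; apply: tauM_leq => s t s0 t0.
apply: le_trans (tauM_ge F' H' (ltW s0) (ltW t0)).
by rewrite le_min !ge_min FF HH orbT.
Qed.

Lemma tauMA : associative (@tauM R).
Proof.
(* One inequality suffices: commutativity turns it into the other. If it failed at x, the right-hand
   value would serve as level, and x = s + (t + u) is regrouped. *)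
have h F H K : ddf_leq (tauM F (tauM H K)) (tauM (tauM F H) K).
  apply: ddf_leq_pos => x x0; rewrite leNgt; apply/negP => lt.
  have [s [r [s0 r0 srx Fs]]] := tauM_lt (ddf_ge0 _ _) lt.
  move=> /(tauM_lt (ddf_ge0 _ _))[t [u [t0 u0 tur Ht Ku]]].
  have := tauM_ge (tauM F H) K (ltW (addr_gt0 s0 t0)) (ltW u0).
  rewrite -addrA tur srx leNgt => /negP; apply; rewrite lt_min Ku andbT.
  by apply: lt_le_trans (tauM_ge F H (ltW s0) (ltW t0)); rewrite lt_min Fs.
move=> F H K; apply: ddf_leq_anti; first exact: h.
by rewrite [tauM (tauM F H) K]tauMC [tauM F (tauM H K)]tauMC (tauMC F)
  (tauMC H K); exact: h.
Qed.

Lemma tauM0F : left_id (eps0 R) (@tauM R).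
Proof.
move=> F; apply: ddf_leq_anti.
  apply: tauM_leq => s t s0 t0; rewrite ge_min; apply/orP; right.
  by apply: ddf_nd; rewrite lee_fin; lra.
apply: ddf_leq_pos => x x0; rewrite leNgt; apply/negP => lt.
(* Left-continuity leaves room x - y > 0, where [eps0] is already 1. *)
have [y yx] := ddf_left_lt x0 lt.
apply/negP; rewrite -leNgt.
have [y0|y0] := leP 0 y; last first.
  by rewrite (ddf_le0 F (x := y%:E)) ?ddf_ge0// lee_fin ltW.
have xy : 0 < x - y by rewrite subr_gt0.
have := tauM_ge (eps0 R) F (ltW xy) y0.
rewrite subrK; apply: le_trans.
by rewrite /= /eps0_fun lte_fin xy le_min ddf_le1 /=.
Qed.

Lemma tauM_triangle : triangle_function (@tauM R).
Proof.
split; [exact: tauMC|exact: tauMA|exact: tauM_monotone|].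
by split=> F; rewrite ?[tauM F _]tauMC tauM0F.
Qed.

Lemma minM_triangle : triangle_function (@minM R).
Proof.
have MC : commutative (@minM R) by move=> F H; apply: ddfP => x; exact: minC.
have M0 : left_id (eps0 R) (@minM R).
  move=> F; apply: ddfP => x; rewrite /= /minM_fun.
  by apply/min_idPr; exact: ddf_leq_eps0.
split => //.
- by move=> F H K; apply: ddfP => x; exact: minA.
- move=> F F' H H' FF HH x.
  by rewrite /= /minM_fun le_min !ge_min FF HH orbT.
- by split=> // F; rewrite MC.
Qed.

(** * Weak continuity of tau_M and M *)

Lemma weak_near_gt F x a : a < F x%:E -> nbhs F [set K : ddf R | a < K x%:E].
Proof.
move=> aF; have [a0|a0] := ltP a 0.
  by apply: filterE => K; exact: lt_le_trans (ddf_ge0 _ _).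
(* Left-continuity keeps the inequality at some y < x; a continuity point between y and x then
   bounds K x from below even if F jumps at x. *)
have [y yx aFy] := ddf_left_lt (ddf_gt0 a0 aF) aF.
have [z /andP[yz zx] Fz] := continuity_point_dense F yx.
have aFz : 0 < F z%:E - a.
  by rewrite subr_gt0 (lt_le_trans aFy)// ddf_nd// lee_fin ltW.
have : nbhs F _ := weak_nbhs_point Fz aFz; apply: filterS => K /=.
rewrite ltr_norml => /andP[+ _].
have : K z%:E <= K x%:E by rewrite ddf_nd// lee_fin ltW.
by lra.
Qed.

(** The gap from x to y leaves room for a continuity point; F may jump just after x, so a bound at x
    alone would not do. *)
Lemma weak_near_lt F x y b : x < y -> F y%:E < b ->
  nbhs F [set K : ddf R | K x%:E < b].
Proof.
move=> xy Fb; have [z /andP[xz zy] Fz] := continuity_point_dense F xy.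
have Fzb : 0 < b - F z%:E.
  by rewrite subr_gt0 (le_lt_trans _ Fb)// ddf_nd// lee_fin ltW.
have : nbhs F _ := weak_nbhs_point Fz Fzb; apply: filterS => K /=.
rewrite ltr_norml => /andP[_ +].
have : K x%:E <= K z%:E by rewrite ddf_nd// lee_fin ltW.
by lra.
Qed.

Lemma weakly_continuous_semi (T : ddf R -> ddf R -> ddf R) :
  (forall F H x a, 0 <= a -> a < T F H x%:E ->
    nbhs (F, H) [set K | a < T K.1 K.2 x%:E]) ->
  (forall F H x y b, x < y -> 0 < b -> T F H y%:E < b ->
    nbhs (F, H) [set K | T K.1 K.2 x%:E <= b]) ->
  weakly_continuous T.
Proof.
move=> lo up [F H]; apply/weak_cvgP => x Tx /=; apply/cvgrPdist_lt => e e0.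
have e20 : 0 < e / 2 by rewrite divr_gt0.
have [y xy Ty] : exists2 y, x < y & T F H y%:E < T F H x%:E + e / 2.
  have /cvgrPdist_lt/(_ _ e20)/nbhs_ballP[d /= d0 dT] := Tx.
  exists (x + d / 2); first by rewrite ltrDl divr_gt0.
  have : ball x d (x + d / 2).
    rewrite /ball/= ltr_norml; apply/andP; split; lra.
  by move=> /dT /=; rewrite ltr_norml => /andP[]; lra.
have b0 : 0 < T F H x%:E + e / 2 by rewrite ltr_wpDl// ddf_ge0.
have [a0|a0] := leP 0 (T F H x%:E - e).
  have aT : T F H x%:E - e < T F H x%:E by rewrite ltrBlDr ltrDl.
  apply: filterS2 (lo _ _ _ _ a0 aT) (up _ _ _ _ _ xy b0 Ty) => -[F' H'] /=.
  by move=> h1 h2; rewrite ltr_norml; apply/andP; split; lra.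
(* For a negative level the lower bound is automatic, values being nonnegative. *)
apply: filterS (up _ _ _ _ _ xy b0 Ty) => -[F' H'] /= h1.
have h2 := ddf_ge0 (T F' H') x%:E.
by rewrite ltr_norml; apply/andP; split; lra.
Qed.

Lemma minM_continuous : weakly_continuous (@minM R).
Proof.
apply: weakly_continuous_semi => [F H x a a0|F H x y b xy b0].
- rewrite /= /minM_fun lt_min => /andP[/weak_near_gt Fa /weak_near_gt Ha].
  exists ([set K : ddf R | a < K x%:E], [set K : ddf R | a < K x%:E]) => //.
  by move=> -[F' H'] /= [h1 h2]; rewrite lt_min h1 h2.
- rewrite /= /minM_fun gt_min => /orP[|] /(weak_near_lt xy) h.
  + exists ([set K : ddf R | K x%:E < b], setT) => /=.
      by split=> //; exact: filterT.
    by move=> -[F' H'] /= [/ltW h1 _]; rewrite ge_min h1.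
  + exists (setT, [set K : ddf R | K x%:E < b]) => /=.
      by split=> //; exact: filterT.
    by move=> -[F' H'] /= [_ /ltW h1]; rewrite ge_min h1 orbT.
Qed.

(** Just past the last point where F stays below b, the minimum forces H below b at the
    complementary point. Half of d is spent on each side of that point. The cap |y| keeps [A]
    bounded when F is below b at every real. *)
Lemma tauM_split F H y b d : 0 < b -> 0 < d -> tauM F H y%:E < b ->
  exists s t, [/\ F s%:E < b, H t%:E < b & s + t = y - d].
Proof.
move=> b0 d0 Tb; pose A := [set s | s <= `|y| /\ F s%:E < b].
have A0 : A 0 by split=> //; rewrite ddf_le0.
have supA : has_sup A by split; [exists 0|exists `|y| => s []].
have d20 : 0 < d / 2 by rewrite divr_gt0.
exists (sup A - d / 2), (y - sup A - d / 2); split; last by lra.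
  have [s [_ Fs] As] := sup_adherent d20 supA.
  by apply: le_lt_trans Fs; rewrite ddf_nd// lee_fin ltW.
set s := sup A + d / 2; have -> : y - sup A - d / 2 = y - s by rewrite /s; lra.
have [t0|t0] := leP (y - s) 0; first by rewrite ddf_le0.
have s0 : 0 <= s by rewrite addr_ge0 ?(ltW d20)// (ub_le_sup supA.2).
(* Here s < y, so s respects the cap and F s < b would put s in [A], beyond its supremum. *)
have Fs : b <= F s%:E.
  rewrite leNgt; apply/negP => Fs; have As : A s.
    by split=> //; rewrite (le_trans _ (ler_norm y))//; lra.
  by have := ub_le_sup supA.2 As; rewrite /s; lra.
have := le_lt_trans (tauM_ge F H s0 (ltW t0)).
rewrite addrC subrK => /(_ _ Tb).
by rewrite gt_min ltNge Fs.
Qed.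

Lemma tauM_continuous : weakly_continuous (@tauM R).
Proof.
apply: weakly_continuous_semi => [F H x a a0|F H x y b xy b0].
- move=> /(tauM_lt a0)[s [t [s0 t0 stx /weak_near_gt Fa /weak_near_gt Ha]]].
  exists ([set K : ddf R | a < K s%:E], [set K : ddf R | a < K t%:E]) => //.
  move=> -[F' H'] /= [h1 h2]; rewrite -stx.
  by apply: lt_le_trans (tauM_ge F' H' (ltW s0) (ltW t0)); rewrite lt_min h1.
(* The split points sum to y - (y - x) / 2; moving each left by (y - x) / 4 makes the sum exactly x.
   A splitting of x with both values above b would have both parts beyond these points, hence too
   large a sum. *)
- have d0 : 0 < (y - x) / 2 by rewrite divr_gt0// subr_gt0.
  have d20 : 0 < (y - x) / 4 by rewrite divr_gt0// subr_gt0.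
  move=> /(tauM_split b0 d0)[s [t [Fs Ht st]]].
  have ss : s - (y - x) / 4 < s by lra.
  have tt : t - (y - x) / 4 < t by lra.
  exists ([set K : ddf R | K (s - (y - x) / 4)%:E < b],
          [set K : ddf R | K (t - (y - x) / 4)%:E < b]) => /=.
    by split; [exact: weak_near_lt ss Fs|exact: weak_near_lt tt Ht].
  move=> -[F' H'] /= [h1 h2]; rewrite leNgt; apply/negP.
  move=> /(tauM_lt (ltW b0))[s' [t' [s'0 t'0 st' Fs' Ht']]].
  have lt (K : ddf R) u v : K u%:E < b -> b < K v%:E -> u < v.
    move=> Ku Kv; rewrite ltNge; apply/negP => vu.
    have : K v%:E <= K u%:E by rewrite ddf_nd// lee_fin.
    by rewrite leNgt (lt_trans Ku).
  by have := lt _ _ _ h1 Fs'; have := lt _ _ _ h2 Ht'; lra.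
Qed.

End Triangle.

(** * Simple spaces and their products *)

Section Simple.
Variables (R : realType) (G : ddf R).

Lemma simple_nuEr (V : normedModType R) (p : V) (x : R) : p <> 0 ->
  simple_nu G p x%:E = G (x / `|p|)%:E.
Proof. by move=> p0; rewrite simple_nuE// -EFinM. Qed.

(** Two spaces are allowed so that a pair can be compared with its components. *)
Lemma simple_nu_le (V W : normedModType R) (p : V) (q : W) : `|q| <= `|p| ->
  ddf_leq (simple_nu G p) (simple_nu G q).
Proof.
move=> qp; have [->|/eqP q0] := eqVneq q 0.
  by rewrite simple_nu0; exact: ddf_leq_eps0.
have q_gt0 := norm_gt0_neq0 q0.
have p0 : p <> 0 by move=> p0; move: qp; rewrite p0 normr0 leNgt q_gt0.
apply: ddf_leq_pos => x x0; rewrite !simple_nuEr//; apply: ddf_nd.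
by rewrite lee_fin ler_pM2l// lef_pV2// posrE norm_gt0_neq0.
Qed.

Lemma simple_nu_eq (V W : normedModType R) (p : V) (q : W) : `|p| = `|q| ->
  simple_nu G p = simple_nu G q.
Proof. by move=> pq; apply: ddf_leq_anti; apply: simple_nu_le; rewrite pq. Qed.

(** For nonzero p, evaluating the distribution at x |p| recovers G x, so the value [eps0] would
    force G itself to be [eps0]. *)
Lemma simple_nu_eps0 (V : normedModType R) (p : V) : G <> eps0 R ->
  simple_nu G p = eps0 R <-> p = 0.
Proof.
move=> G0; split=> [pe|->]; last exact: simple_nu0.
apply: contrapT => p0; apply: G0; apply: ddf_leq_anti.
  exact: ddf_leq_eps0.
have p_gt0 := norm_gt0_neq0 p0.
apply: ddf_leq_pos => x x0.
have := congr1 (fun F : ddf R => F (x * `|p|)%:E) pe.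
rewrite /= simple_nuEr// mulfK ?gt_eqF// => ->.
by rewrite /eps0_fun !lte_fin x0 mulr_gt0.
Qed.

(* (s + t) / (|p| + |q|) is a mean of s / |p| and t / |q|. *)
Lemma simple_nu_add (V : normedModType R) (p q : V) :
  ddf_leq (tauM (simple_nu G p) (simple_nu G q)) (simple_nu G (p + q)).
Proof.
have [->|/eqP p0] := eqVneq p 0; first by rewrite simple_nu0 tauM0F add0r.
have [->|/eqP q0] := eqVneq q 0.
  by rewrite simple_nu0 tauMC tauM0F addr0.
have [->|/eqP pq0] := eqVneq (p + q) 0.
  by rewrite simple_nu0; exact: ddf_leq_eps0.
have p_gt0 := norm_gt0_neq0 p0; have q_gt0 := norm_gt0_neq0 q0.
have pq_gt0 := norm_gt0_neq0 pq0.
apply: tauM_leq => s t s0 t0; rewrite !simple_nuEr// ge_min; apply/orP.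
have pq := ler_normD p q.
have [le|/ltW le] := leP (s / `|p|) (t / `|q|); [left|right];
  apply: ddf_nd; rewrite lee_fin.
- set u := s / `|p| in le *; rewrite ler_pdivlMr//.
  have u0 : 0 <= u by rewrite divr_ge0// ltW.
  have su : s = u * `|p| by rewrite /u divfK ?gt_eqF.
  by move: le; rewrite ler_pdivlMr// => le; rewrite su; nra.
- set u := t / `|q| in le *; rewrite ler_pdivlMr//.
  have u0 : 0 <= u by rewrite divr_ge0// ltW.
  have tu : t = u * `|q| by rewrite /u divfK ?gt_eqF.
  by move: le; rewrite ler_pdivlMr// => le; rewrite tu; nra.
Qed.

Lemma simple_nu_split (V : normedModType R) (a : R) (p : V) : 0 <= a <= 1 ->
  simple_nu G p = tauM (simple_nu G (a *: p)) (simple_nu G ((1 - a) *: p)).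
Proof.
(* At a = 0 and a = 1 one part is the null vector, whose distribution is the identity of tau_M. *)
move=> /andP[]; rewrite le_eqVlt => /predU1P[<- _|a0].
  by rewrite scale0r subr0 scale1r simple_nu0 tauM0F.
rewrite le_eqVlt => /predU1P[->|a1].
  by rewrite subrr scale1r scale0r simple_nu0 tauMC tauM0F.
apply: ddf_leq_anti; last first.
  have := simple_nu_add (a *: p) ((1 - a) *: p).
  by rewrite -scalerDl subrKC scale1r.
have [->|/eqP p0] := eqVneq p 0; first by rewrite !scaler0 !simple_nu0 tauM0F.
have p_gt0 := norm_gt0_neq0 p0.
have b0 : 0 < 1 - a by rewrite subr_gt0.
(* By this homogeneity both terms of the minimum at x = a x + (1 - a) x equal the distribution of p
   at x. *)
have scale (c x : R) : 0 < c ->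
    simple_nu G (c *: p) (c * x)%:E = simple_nu G p x%:E.
  move=> c0; rewrite !simple_nuEr//; last first.
    by move=> /eqP; rewrite scaler_eq0 gt_eqF//= => /eqP.
  by rewrite normrZ gtr0_norm// -mulf_div divff ?gt_eqF// mul1r.
apply: ddf_leq_pos => x x0.
have := tauM_ge (simple_nu G (a *: p)) (simple_nu G ((1 - a) *: p))
  (ltW (mulr_gt0 a0 x0)) (ltW (mulr_gt0 b0 x0)).
by rewrite !scale// minxx -mulrDl subrKC mul1r.
Qed.

Lemma simple_space_PN (V : normedModType R) : G <> eps0 R ->
  is_PN_space (simple_space V G).
Proof.
move=> G0; split=> /=.
- by split; [exact: tauM_triangle|exact: tauM_continuous].
- by split; [exact: minM_triangle|exact: minM_continuous].
- exact: tauM_le_minM.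
- by move=> p; exact: simple_nu_eps0.
- by move=> p; apply: simple_nu_eq; rewrite normrN.
- exact: simple_nu_add.
(* (N4) follows from the Serstnev identity, since tau_M lies below M. *)
- move=> a p a01; rewrite [X in ddf_leq X _](simple_nu_split p a01).
  exact: tauM_le_minM.
Qed.

Lemma simple_nu_pair (V1 V2 : normedModType R) (p : V1 * V2) :
  simple_nu G p = minM (simple_nu G p.1) (simple_nu G p.2).
Proof.
have le1 : `|p.1| <= `|p| by rewrite prod_normE le_max lexx.
have le2 : `|p.2| <= `|p| by rewrite prod_normE le_max lexx orbT.
apply: ddf_leq_anti => x; rewrite /= /minM_fun.
  by rewrite le_min !simple_nu_le.
rewrite ge_min; apply/orP.
have [h|/ltW h] := leP `|p.1| `|p.2|; [right|left]; apply: simple_nu_le.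
  by rewrite prod_normE ge_max h lexx.
by rewrite prod_normE ge_max h lexx.
Qed.

End Simple.

(* The norm of the library's normed space V1 * V2 is the maximum norm; the
   first conjunct makes this explicit. *)
Theorem theorem4 (R : realType) (V1 V2 : normedModType R) (G : ddf R)
    (Gneq0 : G <> eps0 R) (Gneqy : G <> epsy R) :
  (forall p : V1 * V2, `|p| = Num.max `|p.1| `|p.2|) /\
  [/\ is_PN_space (simple_space (V1 * V2)%type G),
      simple_space (V1 * V2)%type G =
        M_product (simple_space V1 G) (simple_space V2 G) &
      is_Serstnev_space (simple_space (V1 * V2)%type G)].
Proof.
split=> [p|]; first exact: prod_normE.
split; first exact: simple_space_PN.
- rewrite /simple_space /M_product /=.
  (* Carriers and triangle functions agree by conversion; only the probabilistic norms remain to be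
     identified. *)
  have -> : @simple_nu R (V1 * V2)%type G =
      (fun p => minM (simple_nu G p.1) (simple_nu G p.2)).
    by apply/funext => p; exact: simple_nu_pair.
  by [].
- split; first exact: simple_space_PN.
  by move=> a p; exact: simple_nu_split.
Qed.
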